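(* Let $f:\mathbb{R}^n\to\mathbb{R}\cup\{+\infty\}$ be proper, lower semicontinuous and convex, $A\in\mathbb{R}^{m\times n}$, $b\in\mathbb{R}^m$, and let $(x^*,\lambda^* )\in\Omega$, the set of KKT points of the problem $\min_x f(x)$ s.t. $Ax=b$. Let $\alpha>1$, $\theta\in\mathbb{R}$, let $(\beta_k)_{k\ge1}$ be positive real numbers and $(\epsilon_k)_{k\ge1}\subset\mathbb{R}^n$, and let $\{(x_k,y_k,\lambda_k)\}_{k\ge1}$ be a sequence generated by the fast primal-dual algorithm (described in the context) with these parameters. Assume that there exists an integer $k_1\ge\max\{2,\theta\}$ such that $$\beta_{k+1}\le\frac{k(k+\alpha-\theta)}{(k+1)(k+2-\theta)}\,\beta_k\qquad\text{for all } k\ge k_1-1,$$ and that $$\sum_{k=1}^{+\infty}k\|\epsilon_k\|<+\infty,\qquad \lim_{k\to+\infty}k^2\beta_k=+\infty.$$ Then the sequence $\{(y_k,\lambda_k)\}_{k\ge k_1}$ is bounded, and as $k\to+\infty$ $$\|Ax_k-b\|=\mathcal{O}\left(\frac{1}{k^2\beta_k}\right),\qquad |f(x_k)-f(x^* )|=\mathcal{O}\left(\frac{1}{k^2\beta_k}\right).$$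
   Context: $\|\cdot\|$ is the Euclidean norm and $\partial f(x)=\{v\in\mathbb{R}^n: f(y)\ge f(x)+\langle v,y-x\rangle\ \forall y\in\mathbb{R}^n\}$. The KKT set $\Omega$ consists of all $(x^*,\lambda^* )\in\mathbb{R}^n\times\mathbb{R}^m$ with $-A^T\lambda^*\in\partial f(x^* )$ and $Ax^*=b$ (assumed nonempty). Fast primal-dual algorithm. Choose $x_0\in\mathbb{R}^n$, $\lambda_0\in\mathbb{R}^m$; set $x_1=x_0$, $\lambda_1=\lambda_0$ (and $y_1=x_1$). For $k=1,2,\dots$: Step 1: $\bar x_k=x_k+\frac{k-\theta}{k+\alpha-\theta}(x_k-x_{k-1})$. Step 2: with $\vartheta_k=\frac{k(k+\alpha-\theta)\beta_k}{\alpha-1}$ and $\eta_k=\frac{k+1-\theta}{k+\alpha-\theta}Ax_k+\frac{\alpha-1}{k+\alpha-\theta}b$, let $x_{k+1}$ be a minimizer over $x\in\mathbb{R}^n$ of $$f(x)+\frac{k+\alpha-\theta}{2k\beta_k}\|x-\bar x_k\|^2+\frac{\vartheta_k}{2}\|Ax-\eta_k\|^2+\Big\langle A^T\lambda_k-\frac{\epsilon_k}{\beta_k},x\Big\rangle .$$ Step 3: $y_{k+1}=x_{k+1}+\frac{k+1-\theta}{\alpha-1}(x_{k+1}-x_k)$ and $\lambda_{k+1}=\lambda_k+k\beta_k(Ay_{k+1}-b)$. The algorithm is run without stopping, and ''a sequence generated by the algorithm'' means an infinite sequence for which all these steps are well defined (in particular $k+\alpha-\theta\neq0$ for all $k\ge1$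 and the minimizers exist). *)

(* Defs.v *)
From HB Require Import structures.
From mathcomp Require Import all_boot all_order all_algebra.
From mathcomp Require Import all_classical all_reals all_analysis.

Set Implicit Arguments.
Unset Strict Implicit.
Unset Printing Implicit Defensive.

Import Order.TTheory GRing.Theory Num.Theory.
Import numFieldNormedType.Exports.

Local Open Scope classical_set_scope.
Local Open Scope ring_scope.

Definition dot (R : realType) (n : nat) (u v : 'cV[R]_n) : R :=
  \sum_(i < n) u i 0 * v i 0.

(* The library norm `|_| on matrices is the sup norm, hence this definition. *)
Definition l2norm (R : realType) (n : nat) (u : 'cV[R]_n) : R :=
  Num.sqrt (dot u u).

Definition proper_fun (R : realType) (T : Type) (f : T -> \bar R) : Prop :=
  (forall x, f x <> -oo%E) /\ (exists x, f x <> +oo%E).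

(* Meant for functions that avoid -oo, so that the right-hand side never
   contains -oo + +oo. *)
Definition econvex_fun (R : realType) (n : nat) (f : 'cV[R]_n -> \bar R) : Prop :=
  forall (x y : 'cV[R]_n) (t : R), 0 < t < 1 ->
    (f (t *: x + (1 - t) *: y)%R <= t%:E * f x + (1 - t)%:E * f y)%E.

Definition subdifferential (R : realType) (n : nat) (f : 'cV[R]_n -> \bar R)
    (x : 'cV[R]_n) : set 'cV[R]_n :=
  [set v | forall y : 'cV[R]_n, (f x + (dot v (y - x)%R)%:E <= f y)%E].

Definition kkt_set (R : realType) (n m : nat) (f : 'cV[R]_n -> \bar R)
    (A : 'M[R]_(m, n)) (b : 'cV[R]_m) : set ('cV[R]_n * 'cV[R]_m) :=
  [set p | subdifferential f p.1 (- (A^T *m p.2)) /\ A *m p.1 = b].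

Definition is_minimizer (R : realType) (T : Type) (g : T -> \bar R) (x : T) : Prop :=
  forall z, (g x <= g z)%E.

Section algorithm.
Variables (R : realType) (n m : nat) (f : 'cV[R]_n -> \bar R).
Variables (A : 'M[R]_(m, n)) (b : 'cV[R]_m) (alpha theta : R).
Variables (beta : nat -> R) (eps : nat -> 'cV[R]_n).
Variables (x y : nat -> 'cV[R]_n) (lambda : nat -> 'cV[R]_m).

Definition xbar (k : nat) : 'cV[R]_n :=
  x k + ((k%:R - theta) / (k%:R + alpha - theta)) *: (x k - x k.-1).

Definition vartheta (k : nat) : R :=
  k%:R * (k%:R + alpha - theta) * beta k / (alpha - 1).

Definition eta_pt (k : nat) : 'cV[R]_m :=
  ((k%:R + 1 - theta) / (k%:R + alpha - theta)) *: (A *m x k)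
  + ((alpha - 1) / (k%:R + alpha - theta)) *: b.

Definition subproblem (k : nat) (z : 'cV[R]_n) : \bar R :=
  (f z + ((k%:R + alpha - theta) / (2 * k%:R * beta k) * l2norm (z - xbar k) ^+ 2
          + vartheta k / 2 * l2norm (A *m z - eta_pt k) ^+ 2
          + dot (A^T *m lambda k - (beta k)^-1 *: eps k) z)%:E)%E.

(* x and lambda are indexed from 0 and y from 1: the values beta 0, eps 0 and
   y 0 are unconstrained and never used. *)
Definition fast_primal_dual : Prop :=
  [/\ x 1 = x 0, lambda 1 = lambda 0, y 1 = x 1 &
   forall k : nat, (1 <= k)%N ->
   [/\ k%:R + alpha - theta != 0,
       is_minimizer (subproblem k) (x k.+1),
       y k.+1 = x k.+1 + ((k%:R + 1 - theta) / (alpha - 1)) *: (x k.+1 - x k) &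
       lambda k.+1 = lambda k + (k%:R * beta k) *: (A *m y k.+1 - b)]].

End algorithm.

(* Big-O at infinity for an extended-real sequence u against a real one v (the
   library's =O_ needs u in a normed space).  It forces u to be eventually
   finite. *)
Definition ereal_bigO (R : realType) (u : nat -> \bar R) (v : nat -> R) : Prop :=
  exists C : R, \forall k \near \oo, (`|u k| <= (C * `|v k|)%:E)%E.

(* Main.v *)
(* The optimality condition of the subproblem is
     - A^T lambda_{k+1} - (alpha - 1)/(k beta_k) (y_{k+1} - y_k) + eps_k/beta_k
     \in subdifferential of f at x_{k+1}.
   Testing it against y_{k+1} - xs makes the energy
     k beta_k s_k (L(x_k) - L(xs)) + |lambda_k - ls|^2/2
       + (alpha - 1)/2 |y_k - xs|^2,
   where s_k = (k + 1 - theta)/(alpha - 1) and L = f + <ls, A - b>, grow by at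
   most k |eps_k| |y_{k+1} - xs| per step; the condition on beta says exactly
   that (k+1) beta_{k+1} s_{k+1} <= k beta_k (1 + s_k).  Hence the energy is
   bounded, which bounds y and lambda and gives the rate for L(x_k) - L(xs).  As
   lambda_{k+1} - lambda_k is a weighted difference of consecutive residuals
   A x_k - b, boundedness of lambda then gives the rate for the residuals. *)

Require Import Defs.
From HB Require Import structures.
From mathcomp Require Import all_boot all_order all_algebra.
From mathcomp Require Import all_classical all_reals all_analysis.
From mathcomp Require Import ring lra.

Set Implicit Arguments.
Unset Strict Implicit.
Unset Printing Implicit Defensive.

Import Order.TTheory GRing.Theory Num.Theory.
Import numFieldNormedType.Exports.

Local Open Scope classical_set_scope.
Local Open Scope ring_scope.

(** * Euclidean inner product and norm *)

Section dot_theory.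
Variables (R : realType) (n : nat).
Implicit Types u v w : 'cV[R]_n.

Lemma dotC u v : dot u v = dot v u.
Proof. by apply: eq_bigr => i _; rewrite mulrC. Qed.

Lemma dotDl u v w : dot (u + v) w = dot u w + dot v w.
Proof. by rewrite -big_split; apply: eq_bigr => i _; rewrite mxE mulrDl. Qed.

Lemma dotZl a u v : dot (a *: u) v = a * dot u v.
Proof. by rewrite mulr_sumr; apply: eq_bigr => i _; rewrite mxE mulrA. Qed.

Lemma dotNl u v : dot (- u) v = - dot u v.
Proof. by rewrite -scaleN1r dotZl mulN1r. Qed.

Lemma dotBl u v w : dot (u - v) w = dot u w - dot v w.
Proof. by rewrite dotDl dotNl. Qed.

Lemma dotDr u v w : dot u (v + w) = dot u v + dot u w.
Proof. by rewrite dotC dotDl !(dotC u). Qed.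

Lemma dotZr a u v : dot u (a *: v) = a * dot u v.
Proof. by rewrite dotC dotZl dotC. Qed.

Lemma dotNr u v : dot u (- v) = - dot u v.
Proof. by rewrite dotC dotNl dotC. Qed.

Lemma dotBr u v w : dot u (v - w) = dot u v - dot u w.
Proof. by rewrite dotDr dotNr. Qed.

Lemma dot_ge0 u : 0 <= dot u u.
Proof. by apply: sumr_ge0 => i _; rewrite -expr2 sqr_ge0. Qed.

Lemma dot_eq0 u : dot u u = 0 -> u = 0.
Proof.
move/eqP; rewrite psumr_eq0 => [/allP u0|i _]; last by rewrite -expr2 sqr_ge0.
apply/colP => i; have := u0 i (mem_index_enum i).
by rewrite -expr2 sqrf_eq0 mxE => /eqP.
Qed.

Lemma l2norm_ge0 u : 0 <= l2norm u.
Proof. exact: sqrtr_ge0. Qed.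

Lemma sqr_l2norm u : l2norm u ^+ 2 = dot u u.
Proof. by rewrite sqr_sqrtr ?dot_ge0. Qed.

Lemma l2normZ a u : l2norm (a *: u) = `|a| * l2norm u.
Proof.
by rewrite /l2norm dotZl dotZr mulrA -expr2 sqrtrM ?sqr_ge0// sqrtr_sqr.
Qed.

Lemma l2normN u : l2norm (- u) = l2norm u.
Proof. by rewrite -scaleN1r l2normZ normrN1 mul1r. Qed.

Lemma cauchy_schwarz u v : `|dot u v| <= l2norm u * l2norm v.
Proof.
rewrite -[leRHS]ger0_norm ?mulr_ge0 ?l2norm_ge0//.
rewrite -ler_sqr ?nnegrE// !real_normK ?num_real// exprMn !sqr_l2norm.
have [/dot_eq0 ->|v0] := eqVneq (dot v v) 0.
  by rewrite -(scale0r 0) !dotZr !mul0r mulr0 expr0n.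
have vv : 0 < dot v v by rewrite lt_def v0 dot_ge0.
(* This vector is [dot v v] times the component of [u] orthogonal to [v]; its squared norm is
   [dot v v] times the Cauchy-Schwarz defect. *)
have := dot_ge0 (dot v v *: u - dot u v *: v).
rewrite !(dotBl, dotBr, dotZl, dotZr) (dotC v u) => h.
by rewrite -(ler_pM2l vv); lra.
Qed.

Lemma l2normD u v : l2norm (u + v) <= l2norm u + l2norm v.
Proof.
rewrite -ler_sqr ?nnegrE ?addr_ge0 ?l2norm_ge0//.
rewrite sqrrD !sqr_l2norm !(dotDl, dotDr) (dotC v u).
have := cauchy_schwarz u v; have := ler_norm (dot u v); lra.
Qed.

Lemma l2normB u v : l2norm (u - v) <= l2norm u + l2norm v.
Proof. by rewrite -(l2normN v) l2normD. Qed.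

End dot_theory.

Lemma dot_trmx (R : realType) (n m : nat) (A : 'M[R]_(m, n)) u v :
  dot (A^T *m u) v = dot u (A *m v).
Proof.
rewrite /dot; under eq_bigr => i _ do rewrite mxE mulr_suml.
rewrite exchange_big; apply: eq_bigr => j _; rewrite mxE mulr_sumr.
by apply: eq_bigr => i _; rewrite mxE mulrCA mulrA.
Qed.

(** * Subgradients and first-order optimality *)

Lemma le_of_le_addr_mul (R : realType) (a b c : R) :
  (forall t, 0 < t < 1 -> a <= b + t * c) -> a <= b.
Proof.
move=> h; rewrite leNgt; apply/negP => ba.
have cp : 0 <= `|c| by [].
have cn := ler_norm c.
(* For this [t] the product of [t] and |c| is below half of [a - b], which contradicts the assumed
   bound at [t]. *)
pose t := (a - b) / (2 * (`|c| + (a - b))).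
have d0 : 0 < 2 * (`|c| + (a - b)) by lra.
have t0 : 0 < t by rewrite divr_gt0//; lra.
have t1 : t < 1 by rewrite ltr_pdivrMr//; lra.
have tE : t * (2 * (`|c| + (a - b))) = a - b by rewrite divfK// gt_eqF.
have := h t; rewrite t0 t1 => /(_ isT).
have tc : t * c <= t * `|c| by rewrite ler_pM2l.
have : 0 < t * (a - b) by rewrite mulr_gt0// subr_gt0.
lra.
Qed.

Section convex_analysis.
Variables (R : realType) (n : nat) (f : 'cV[R]_n -> \bar R).
Hypothesis f_proper : proper_fun f.

(** A subgradient at a point where [f] is [+oo] would force [f] to be [+oo] everywhere, against
    properness. *)
Lemma subdifferential_fin_num x v : subdifferential f x v -> f x \is a fin_num.
Proof.
case: f_proper => fNy [z fz] /(_ z).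
by move: (fNy x) (fNy z) fz; case: (f x) (f z) => [r||] [s||].
Qed.

Lemma minimizer_fin_num (q : 'cV[R]_n -> R) x z :
  is_minimizer (fun z => f z + (q z)%:E)%E x -> f z \is a fin_num ->
  f x \is a fin_num.
Proof.
case: f_proper => fNy _ /(_ z).
by move: (fNy x); case: (f x) (f z) => [r||] [s||].
Qed.

(* No sign is required of the second-order term [Q]: it disappears as [t]
   tends to 0. *)
Lemma minimizer_subdifferential (q Q : 'cV[R]_n -> R) x v :
  econvex_fun f ->
  (forall t z, q (x + t *: (z - x)) = q x - t * dot v (z - x) + t ^+ 2 * Q z) ->
  f x \is a fin_num ->
  is_minimizer (fun z => f z + (q z)%:E)%E x -> subdifferential f x v.
Proof.
case: f_proper => fNy _ f_convex qE fx xmin z.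
case fxE: (f x) fx => [p||] // _; have := fNy z.
case fz: (f z) => [r||] // _; last by rewrite leey.
rewrite -EFinD lee_fin; apply: (@le_of_le_addr_mul _ _ _ (Q z)) => t t01.
(* Minimality against the segment point, convexity along the segment and division by [t] leave only
   the error [t * Q z]. *)
have := f_convex z x t t01; have := xmin (x + t *: (z - x)).
have -> : t *: z + (1 - t) *: x = x + t *: (z - x).
  by apply/colP => i; rewrite !mxE; ring.
rewrite fz fxE qE; have := fNy (x + t *: (z - x)).
case: (f _) => [s||] //; rewrite -!EFinM -!EFinD !lee_fin => _ fxs sr.
have [t0 t1] := andP t01; rewrite -(ler_pM2l t0).
have -> : t * (r + t * Q z) = t * r + t ^+ 2 * Q z by ring.
lra.
Qed.
End convex_analysis.


(** * Boundedness of sequences from recursive relations *)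

Lemma energy_bounded (R : realType) (c S : R) (E D e : nat -> R) :
  0 < c -> (forall k, 0 <= e k) -> (forall k, 0 <= D k) ->
  (forall k, c * D k ^+ 2 <= E k) ->
  (forall k, E k.+1 <= E k + e k * D k.+1) ->
  (forall k, \sum_(i < k) e i <= S) -> exists B, forall k, E k <= B.
Proof.
move=> c0 e0 D0 DE EE eS.
have E00 : 0 <= E 0 by rewrite (le_trans _ (DE 0))// mulr_ge0 ?sqr_ge0 ?ltW.
have S0 : 0 <= S by have := eS 0; rewrite big_ord0.
(* [C] is such that d > C forces c d^2 > c C d = (c + E 0 + S) d > E 0 + S d, the last step because
   d > 1. *)
pose C := 1 + (E 0 + S) / c.
have C1 : 1 <= C by rewrite lerDl divr_ge0 ?addr_ge0 // ltW.
have cC : c * C = c + E 0 + S.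
  by rewrite /C mulrDr mulr1 mulrCA divff ?gt_eqF// mulr1 addrA.
clearbody C.
have D_le d : 0 <= d -> c * d ^+ 2 <= E 0 + S * Num.max C d -> d <= C.
  move=> d0; rewrite [d <= C]leNgt; apply: contraTN => Cd; rewrite -ltNge.
  rewrite max_r ?ltW//.
  have d1 : 1 < d by apply: le_lt_trans C1 Cd.
  have : c * C * d < c * d * d by rewrite ltr_pM2r ?ltr_pM2l//; lra.
  rewrite cC expr2 mulrA; apply: le_lt_trans.
  have : E 0 <= E 0 * d by rewrite ler_peMr// ltW.
  have : 0 < c * d by rewrite mulr_gt0//; lra.
  lra.
(* The recursion is implicit: [E k.+1] is bounded through [D k.+1], itself controlled by [E k.+1].
   The quadratic lower bound breaks the circle: it gives [D k.+1 <= C] first, and the energy bound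
   follows. *)
have EC k : E k <= E 0 + C * \sum_(i < k) e i /\ D k <= C.
  elim: k => [|k [IHE IHD]].
    rewrite big_ord0 mulr0 addr0; split=> //; apply: D_le => //.
    rewrite (le_trans (DE 0))// lerDl mulr_ge0// le_max; lra.
  have DC : D k.+1 <= C.
    apply: D_le => //; apply: le_trans (DE _) _; apply: le_trans (EE k) _.
    apply: le_trans (lerD IHE (lexx _)) _; rewrite -addrA lerD2l.
    have M1 : C <= Num.max C (D k.+1) by rewrite le_max lexx.
    have M2 : D k.+1 <= Num.max C (D k.+1) by rewrite le_max lexx orbT.
    apply: (@le_trans _ _ ((\sum_(i < k.+1) e i) * Num.max C (D k.+1))).
      rewrite big_ord_recr /= mulrDl lerD ?ler_wpM2l// mulrC ler_wpM2l//.
      exact: sumr_ge0.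
    by rewrite ler_wpM2r// le_max; lra.
  split=> //; apply: le_trans (EE k) _; rewrite big_ord_recr /= mulrDr addrA lerD//.
  by rewrite mulrC ler_wpM2r.
exists (E 0 + C * S) => k; apply: le_trans (EC k).1 _.
rewrite lerD2l ler_wpM2l//; lra.
Qed.

(* The shifted sequence [b k *: r k.+1 - lam k.+1] moves, at each step, to a
   convex combination of itself and of the bounded [- lam k.+1], with
   coefficient [a k.+1 / b k]. *)
Lemma bounded_of_increments (R : realType) (m : nat) (r lam : nat -> 'cV[R]_m)
    (a b : nat -> R) (M : R) :
  (forall k, 0 <= a k) -> (forall k, 0 < b k) -> (forall k, a k.+1 <= b k) ->
  (forall k, lam k.+1 - lam k = b k *: r k.+1 - a k *: r k) ->
  (forall k, l2norm (lam k) <= M) ->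
  exists C, forall k, b k * l2norm (r k.+1) <= C.
Proof.
move=> a0 b0 ab lamE lamM.
pose K := Num.max M (l2norm (b 0 *: r 1 - lam 1)).
have MK : M <= K by rewrite le_max lexx.
have hK k : l2norm (b k *: r k.+1 - lam k.+1) <= K.
  elim: k => [|k IHk]; first by rewrite le_max lexx orbT.
  pose q := a k.+1 / b k.
  have q0 : 0 <= q by rewrite divr_ge0// ltW.
  have q1 : q <= 1 by rewrite ler_pdivrMr// mul1r.
  (* The increment relation reduces the left side to [a k.+1 *: r k.+1 - lam k.+1], and [q * b k] is
     [a k.+1]. *)
  have -> : b k.+1 *: r k.+2 - lam k.+2 =
      q *: (b k *: r k.+1 - lam k.+1) - (1 - q) *: lam k.+1.
    rewrite -(subrK (lam k.+1) (lam k.+2)) lamE scalerBr scalerA divfK ?gt_eqF//.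
    by apply/colP => i; rewrite !mxE; ring.
  apply: le_trans (l2normB _ _) _; rewrite !l2normZ !ger0_norm ?subr_ge0//.
  have := ler_wpM2l q0 IHk.
  have q1' : 0 <= 1 - q by lra.
  have := ler_wpM2l q1' (le_trans (lamM k.+1) MK).
  lra.
exists (K + M) => k; rewrite -{1}[b k]ger0_norm ?(ltW (b0 k))// -l2normZ.
rewrite -[_ *: _](subrK (lam k.+1)); apply: le_trans (l2normD _ _) _.
exact: lerD.
Qed.

(** Supplies the expansion required by [minimizer_subdifferential] for the smooth part of the
    subproblem; the vector under the minus sign is its gradient at [x]. *)
Lemma quadratic_expansion (R : realType) (n m : nat) (A : 'M[R]_(m, n))
    (c d : R) (p l : 'cV[R]_n) (h : 'cV[R]_m) (x u : 'cV[R]_n) (t : R) :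
  let q z := c * l2norm (z - p) ^+ 2 + d / 2 * l2norm (A *m z - h) ^+ 2
             + dot l z in
  q (x + t *: u) =
  q x - t * dot (- ((2 * c) *: (x - p) + d *: (A^T *m (A *m x - h)) + l)) u
  + t ^+ 2 * (c * dot u u + d / 2 * dot (A *m u) (A *m u)).
Proof.
rewrite /= !sqr_l2norm (mulmxDr A x) -scalemxAr.
have -> : x + t *: u - p = (x - p) + t *: u by rewrite addrAC.
have -> : A *m x + t *: (A *m u) - h = (A *m x - h) + t *: (A *m u).
  by rewrite addrAC.
move: (x - p) (A *m x - h) => r s.
rewrite !(dotNl, dotDl, dotDr, dotZl, dotZr, dot_trmx).
rewrite (dotC u r) (dotC (A *m u) s).
by field.
Qed.

(** * The iterates: optimality condition and one-step energy estimate *)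

Section primal_dual.
Variables (R : realType) (n m : nat) (f : 'cV[R]_n -> \bar R).
Variables (A : 'M[R]_(m, n)) (b : 'cV[R]_m) (alpha theta : R).
Variables (beta : nat -> R) (eps : nat -> 'cV[R]_n).
Variables (x y : nat -> 'cV[R]_n) (lambda : nat -> 'cV[R]_m).
Variables (xs : 'cV[R]_n) (ls : 'cV[R]_m).
Hypothesis f_proper : proper_fun f.
Hypothesis f_convex : econvex_fun f.
Hypothesis kkt : kkt_set f A b (xs, ls).
Hypothesis alpha_gt1 : 1 < alpha.
Hypothesis beta_gt0 : forall k, (1 <= k)%N -> 0 < beta k.
Hypothesis algo : fast_primal_dual f A b alpha theta beta eps x y lambda.

Definition extrapolation (k : nat) : R := (k%:R + 1 - theta) / (alpha - 1).

Definition residual (k : nat) : 'cV[R]_m := A *m x k - b.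

(* The value at [x k] of the Lagrangian [f + <ls, A - b>] minus its minimum. *)
Definition lagrangian_gap (k : nat) : R :=
  fine (f (x k)) - fine (f xs) + dot ls (residual k).

Definition energy (k : nat) : R :=
  k%:R * beta k * extrapolation k * lagrangian_gap k
  + l2norm (lambda k - ls) ^+ 2 / 2
  + (alpha - 1) / 2 * l2norm (y k - xs) ^+ 2.

Let alpha1 : alpha - 1 != 0. Proof. by rewrite subr_eq0 gt_eqF. Qed.

Lemma xs_fin_num : f xs \is a fin_num.
Proof. by case: kkt => /(subdifferential_fin_num f_proper). Qed.

(** The starting point is arbitrary, so [f (x 1)] may be [+oo]; a subproblem minimizer is finite by
    comparison with [xs]. *)
Lemma iterate_fin_num k : (2 <= k)%N -> f (x k) \is a fin_num.
Proof.
case: k => [|[|k]] // _; case: algo => _ _ _ /(_ k.+1 isT) [_ xmin _ _].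
exact: minimizer_fin_num xmin xs_fin_num.
Qed.

Lemma lagrangian_gap_ge0 k : (2 <= k)%N -> 0 <= lagrangian_gap k.
Proof.
move=> /iterate_fin_num xk; case: kkt => /= /(_ (x k)) xs_min Axs.
move: xs_min; rewrite -(fineK xk) -(fineK xs_fin_num) -EFinD lee_fin.
by rewrite dotNl dot_trmx mulmxBr Axs /lagrangian_gap /residual; lra.
Qed.

(** Step 3 shifted by one index, so that [y k] and [xbar] involve the same increment; at [k = 1] the
    initial equalities make that increment vanish. *)
Lemma y_extrapolation k : (1 <= k)%N ->
  y k = x k + ((k%:R - theta) / (alpha - 1)) *: (x k - x k.-1).
Proof.
case: algo => x1 _ y1 step; case: k => [|[|k]] // _.
  by rewrite y1 x1 subrr scaler0 addr0.
by have [_ _ -> _] := step k.+1 isT; rewrite natr1.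
Qed.

Lemma y_residual k : (1 <= k)%N ->
  A *m y k.+1 - b =
  (1 + extrapolation k) *: residual k.+1 - extrapolation k *: residual k.
Proof.
case: algo => _ _ _ step k1; have [_ _ -> _] := step k k1.
rewrite mulmxDr -scalemxAr mulmxBr /residual -/(extrapolation k).
move: (A *m x k.+1) (A *m x k) => u v.
by apply/colP => i; rewrite !mxE; ring.
Qed.

Lemma lambda_increment k : (1 <= k)%N ->
  lambda k.+1 - lambda k = (k%:R * beta k * (1 + extrapolation k)) *: residual k.+1
    - (k%:R * beta k * extrapolation k) *: residual k.
Proof.
move=> k1; case: algo => _ _ _ /(_ k k1) [_ _ _ ->].
by rewrite addrAC subrr add0r y_residual// scalerBr !scalerA.
Qed.

(** The coefficients of [xbar] and [eta_pt] are tuned for this: the proximal gradient becomes a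
    multiple of [y k.+1 - y k], and the penalty gradient becomes [A^T] applied to
    [lambda k.+1 - lambda k], which updates the multiplier. *)
Lemma iterate_subgradient k : (1 <= k)%N ->
  subdifferential f (x k.+1)
    (- (A^T *m lambda k.+1) - ((alpha - 1) / (k%:R * beta k)) *: (y k.+1 - y k)
     + (beta k)^-1 *: eps k).
Proof.
move=> k1; have xfin : f (x k.+1) \is a fin_num by apply: iterate_fin_num.
have yk := y_extrapolation k1.
case: algo => _ _ _ /(_ k k1) [ka0 xmin yk1 lamk1].
have k0 : k%:R != 0 :> R by rewrite pnatr_eq0 -lt0n.
have b0 : beta k != 0 by rewrite gt_eqF// beta_gt0.
set v := (X in subdifferential _ _ X).
set c := (k%:R + alpha - theta) / (2 * k%:R * beta k) in xmin.
have -> : v = - ((2 * c) *: (x k.+1 - xbar alpha theta x k)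
    + vartheta alpha theta beta k *:
        (A^T *m (A *m x k.+1 - eta_pt A b alpha theta x k))
    + (A^T *m lambda k - (beta k)^-1 *: eps k)).
  have -> : (2 * c) *: (x k.+1 - xbar alpha theta x k) =
      ((alpha - 1) / (k%:R * beta k)) *: (y k.+1 - y k).
    rewrite yk1 yk /xbar /c; apply/colP => i; rewrite !mxE; field.
    by rewrite ka0 alpha1 k0 b0.
  rewrite scalemxAr.
  have -> : vartheta alpha theta beta k *:
      (A *m x k.+1 - eta_pt A b alpha theta x k) = lambda k.+1 - lambda k.
    rewrite lambda_increment// /residual /vartheta /eta_pt /extrapolation.
    move: (A *m x k.+1) (A *m x k) => u w.
    by apply/colP => i; rewrite !mxE; field; rewrite ka0 alpha1.
  rewrite mulmxBr /v; move: (A^T *m lambda k.+1) (A^T *m lambda k) => u w.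
  by apply/colP => i; rewrite !mxE; ring.
apply: (minimizer_subdifferential f_proper f_convex _ xfin xmin) => t z.
exact: quadratic_expansion.
Qed.

Lemma energy_step k : (2 <= k)%N -> 0 <= extrapolation k ->
  k.+1%:R * beta k.+1 * extrapolation k.+1
    <= k%:R * beta k * (1 + extrapolation k) ->
  energy k.+1 <= energy k + k%:R * l2norm (eps k) * l2norm (y k.+1 - xs).
Proof.
move=> k2 s0 weight_le; have k1 : (1 <= k)%N by apply: ltnW.
have bk := beta_gt0 k1.
have kR : 0 < k%:R :> R by rewrite ltr0n.
have xk1 : f (x k.+1) \is a fin_num by apply: iterate_fin_num; rewrite ltnW.
have sub z : f z \is a fin_num -> fine (f (x k.+1))
    + dot (- (A^T *m lambda k.+1)
           - ((alpha - 1) / (k%:R * beta k)) *: (y k.+1 - y k)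
           + (beta k)^-1 *: eps k) (z - x k.+1) <= fine (f z).
  move=> fz; have := iterate_subgradient k1 z.
  by rewrite -(fineK fz) -(fineK xk1) -EFinD lee_fin.
have g1 := lagrangian_gap_ge0 (leqW k2).
(* Since y_{k+1} - xs = s_k (x_{k+1} - x_k) + (x_{k+1} - xs), the inequality at [x k] weighted by
   s_k and the one at [xs] add up to [key]. *)
have sub_k := ler_wpM2l s0 (sub _ (iterate_fin_num k2)).
have sub_s := sub _ xs_fin_num.
have := cauchy_schwarz (eps k) (y k.+1 - xs).
have := ler_norm (dot (eps k) (y k.+1 - xs)) => /le_trans h /h{h} cs.
set p := k%:R * beta k in weight_le *.
have p0 : 0 < p by rewrite mulr_gt0.
have ysE : y k.+1 - xs =
    (1 + extrapolation k) *: x k.+1 - extrapolation k *: x k - xs.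
  case: algo => _ _ _ /(_ k k1) [_ _ -> _]; rewrite -/(extrapolation k).
  by apply/colP => i; rewrite !mxE; ring.
have AyE : A *m (y k.+1 - xs) = p^-1 *: (lambda k.+1 - lambda k).
  case: algo => _ _ _ /(_ k k1) [_ _ _ ->]; case: kkt => _ /= Axs.
  by rewrite mulmxBr Axs addrAC subrr add0r scalerA mulVf ?scale1r ?gt_eqF.
have rE : (1 + extrapolation k) *: residual k.+1 - extrapolation k *: residual k
    = p^-1 *: (lambda k.+1 - lambda k).
  rewrite -AyE -y_residual// mulmxBr; by case: kkt => _ /= ->.
set v := (X in dot X _) in sub_k sub_s.
have key : (1 + extrapolation k) * fine (f (x k.+1))
    - extrapolation k * fine (f (x k)) - fine (f xs) <= dot v (y k.+1 - xs).
  rewrite ysE; move: sub_k sub_s; rewrite !(dotBr, dotZr); lra.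
(* The multiplier parts of the gaps pair [ls] with the increment of [lambda]; in [main] this
   recentres [lambda k.+1] at [ls]. *)
have gapE : (1 + extrapolation k) * lagrangian_gap k.+1
    - extrapolation k * lagrangian_gap k =
    (1 + extrapolation k) * fine (f (x k.+1))
    - extrapolation k * fine (f (x k)) - fine (f xs)
    + p^-1 * dot ls (lambda k.+1 - lambda k).
  by rewrite -dotZr -rE dotBr !dotZr /lagrangian_gap; ring.
have vE : p * dot v (y k.+1 - xs) = - dot (lambda k.+1) (lambda k.+1 - lambda k)
    - (alpha - 1) * dot (y k.+1 - y k) (y k.+1 - xs)
    + k%:R * dot (eps k) (y k.+1 - xs).
  rewrite /v !dotDl !dotNl !dotZl dot_trmx AyE !dotZr !(dotDl, dotNl) /p; field.
  by rewrite !gt_eqF.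
have main : p * (1 + extrapolation k) * lagrangian_gap k.+1
    - p * extrapolation k * lagrangian_gap k <=
    - dot (lambda k.+1 - ls) (lambda k.+1 - lambda k)
    - (alpha - 1) * dot (y k.+1 - y k) (y k.+1 - xs)
    + k%:R * (l2norm (eps k) * l2norm (y k.+1 - xs)).
  have -> : p * (1 + extrapolation k) * lagrangian_gap k.+1
      - p * extrapolation k * lagrangian_gap k =
      p * ((1 + extrapolation k) * lagrangian_gap k.+1
           - extrapolation k * lagrangian_gap k) by ring.
  rewrite gapE mulrDr (mulrA p) divff ?gt_eqF// mul1r (dotBl (lambda k.+1) ls).
  have := ler_wpM2l (ltW p0) key; have := ler_wpM2l (ltW kR) cs; lra.
(* This three-point identity turns both inner products of [main] into differences of squares, up to
   squared increments of favourable sign. *)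
have polar r (u v' w : 'cV[R]_r) : 2 * dot (u - w) (u - v') =
    l2norm (u - w) ^+ 2 + l2norm (u - v') ^+ 2 - l2norm (v' - w) ^+ 2.
  rewrite !sqr_l2norm !(dotBl, dotBr) (dotC w u) (dotC v' u) (dotC w v'); ring.
have polar_l := polar _ (lambda k.+1) (lambda k) ls.
have polar_y := polar _ (y k.+1) (y k) xs.
rewrite dotC in polar_y.
have sq_l := sqr_ge0 (l2norm (lambda k.+1 - lambda k)).
have sq_y : 0 <= (alpha - 1) * l2norm (y k.+1 - y k) ^+ 2.
  by rewrite mulr_ge0 ?sqr_ge0// subr_ge0 ltW.
(* As the gap is nonnegative, its weight can be lowered to the one in the energy at [k.+1]. *)
have wg := ler_wpM2r g1 weight_le.
move/(congr1 (fun t => (alpha - 1) * t)) : polar_y => polar_y.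
rewrite /energy -/p; nra.
Qed.

End primal_dual.

(** * From the energy bound to the convergence rates *)

Lemma summable_partial_sums (R : realType) (u : nat -> R) :
  (forall k, 0 <= u k) -> (\sum_(1 <= k <oo) (u k)%:E < +oo)%E ->
  exists S, forall k0 N, (1 <= k0)%N -> \sum_(i < N) u (k0 + i)%N <= S.
Proof.
move=> u0 u_fin; pose s := (\sum_(1 <= k <oo) (u k)%:E)%E.
have s0 : (0 <= s)%E by apply: nneseries_ge0 => k _ _; rewrite lee_fin.
have sfin : s \is a fin_num by rewrite ge0_fin_numE.
exists (fine s) => k0 N k01; rewrite -lee_fin (fineK sfin).
apply: le_trans (@nneseries_lim_ge _ _ xpredT 1 (k0 + N) _) => [|k _ _]; last first.
  by rewrite lee_fin.
rewrite sumEFin lee_fin (@big_cat_nat _ _ _ k0)//= ?leq_addr//.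
rewrite -[leLHS]add0r lerD ?sumr_ge0//.
rewrite [leRHS](_ : _ = \sum_(i < N) u (k0 + i)%N)//.
rewrite -{1}[k0]add0n big_addn addKn big_mkord.
by apply: eq_bigr => i _; rewrite addnC.
Qed.

Theorem theorem1 (R : realType) (n m : nat) (f : 'cV[R]_n -> \bar R)
    (A : 'M[R]_(m, n)) (b : 'cV[R]_m)
    (xs : 'cV[R]_n) (ls : 'cV[R]_m)
    (alpha theta : R) (beta : nat -> R) (eps : nat -> 'cV[R]_n)
    (x y : nat -> 'cV[R]_n) (lambda : nat -> 'cV[R]_m) (k1 : nat)
    (f_proper : proper_fun f)
    (f_lsc : lower_semicontinuous f)
    (f_convex : econvex_fun f)
    (kkt : kkt_set f A b (xs, ls))
    (alpha_gt1 : 1 < alpha)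
    (beta_gt0 : forall k, (1 <= k)%N -> 0 < beta k)
    (algo : fast_primal_dual f A b alpha theta beta eps x y lambda)
    (k1_ge2 : (2 <= k1)%N) (k1_getheta : theta <= k1%:R)
    (beta_le : forall k, (k1 - 1 <= k)%N ->
       beta k.+1 <= k%:R * (k%:R + alpha - theta)
                    / ((k%:R + 1) * (k%:R + 2 - theta)) * beta k)
    (eps_summable :
       (\sum_(1 <= k <oo) (k%:R * l2norm (eps k))%:E < +oo)%E)
    (k2beta_cvg : k%:R ^+ 2 * beta k @[k --> \oo] --> +oo%R) :
  [/\ exists M : R, forall k, (k1 <= k)%N ->
        l2norm (y k) <= M /\ l2norm (lambda k) <= M,
      (fun k : nat => l2norm (A *m x k - b)) =O_\oo
        (fun k : nat => (k%:R ^+ 2 * beta k)^-1) &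
      ereal_bigO (fun k : nat => `|f (x k) - f xs|)%E
        (fun k : nat => (k%:R ^+ 2 * beta k)^-1)].
Proof.
pose s := extrapolation alpha theta; pose r := residual A b x.
pose E := energy f A b alpha theta beta x y lambda xs ls.
pose g := lagrangian_gap f A b x xs ls.
(* [w k] weights the gap in the energy at [k]; [W k] is the weight of the gap at [k.+1] produced by
   one step. *)
pose w k := k%:R * beta k * s k.
pose W k := k%:R * beta k * (1 + s k).
have al0 : 0 < alpha - 1 by rewrite subr_gt0.
have k1_le k : (k1 <= k)%N -> theta <= k%:R.
  by move=> ?; apply: le_trans k1_getheta _; rewrite ler_nat.
have s0 k : (k1 <= k)%N -> 0 < s k.
  by move=> /k1_le ?; rewrite divr_gt0//; lra.
have kb0 k : (k1 <= k)%N -> 0 < k%:R * beta k.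
  move=> kk; have k0 : (1 <= k)%N by rewrite (leq_trans _ kk)// ltnW.
  by rewrite mulr_gt0 ?ltr0n ?beta_gt0.
have w0 k : (k1 <= k)%N -> 0 < w k by move=> kk; rewrite mulr_gt0 ?kb0 ?s0.
have W0 k : (k1 <= k)%N -> 0 < W k.
  by move=> kk; rewrite mulr_gt0 ?kb0 ?addr_gt0 ?s0.
have wW k : (k1 <= k)%N -> w k.+1 <= W k.
  move=> kk; have tk := k1_le _ kk.
  have := beta_le k (leq_trans (leq_subr _ _) kk).
  have k0 : 0 <= k%:R :> R by [].
  have d0 : 0 < (k%:R + 1) * (k%:R + 2 - theta) by rewrite mulr_gt0//; lra.
  rewrite mulrAC ler_pdivlMr// -subr_ge0 => h; rewrite -subr_ge0.
  have -> : W k - w k.+1 = (k%:R * (k%:R + alpha - theta) * beta k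
      - beta k.+1 * ((k%:R + 1) * (k%:R + 2 - theta))) / (alpha - 1).
    by rewrite /W /w /s /extrapolation -natr1; field; rewrite gt_eqF.
  exact/divr_ge0/ltW.
have g0 k : (k1 <= k)%N -> 0 <= g k.
  by move/(leq_trans k1_ge2); exact: lagrangian_gap_ge0 f_proper kkt algo _.
have [S S_ge] := summable_partial_sums
  (fun k => mulr_ge0 (ler0n _ k) (l2norm_ge0 (eps k))) eps_summable.
have energyE k : E k = w k * g k + l2norm (lambda k - ls) ^+ 2 / 2
    + (alpha - 1) / 2 * l2norm (y k - xs) ^+ 2 by [].
have [B EB] : exists B, forall k, (k1 <= k)%N -> E k <= B.
  (* Indices are shifted by [k1], from which the extrapolation coefficients are known to be positive
     and the gaps nonnegative. *)
  have [||||||B EB] := @energy_bounded _ ((alpha - 1) / 2) S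
    (fun j => E (k1 + j)%N) (fun j => l2norm (y (k1 + j)%N - xs))
    (fun j => (k1 + j)%:R * l2norm (eps (k1 + j)%N)).
  - by rewrite divr_gt0.
  - by move=> k; rewrite mulr_ge0 ?l2norm_ge0.
  - by move=> k; exact: l2norm_ge0.
  - move=> k; have kk : (k1 <= k1 + k)%N by apply: leq_addr.
    rewrite energyE lerDr; apply: addr_ge0; last by rewrite divr_ge0 ?sqr_ge0.
    by rewrite mulr_ge0 ?g0// ltW ?w0.
  - move=> k; rewrite addnS.
    have kk : (k1 <= k1 + k)%N by apply: leq_addr.
    apply: (energy_step f_proper f_convex kkt alpha_gt1 beta_gt0 algo).
    + exact: leq_trans kk.
    + exact/ltW/s0.
    + exact: wW.
  - by move=> k; apply: S_ge; rewrite ltnW.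
  by exists B => k kk; rewrite -(subnKC kk).
have wgB k : (k1 <= k)%N -> w k * g k <= B.
  move=> kk; apply: le_trans (EB _ kk); rewrite energyE -addrA lerDl.
  by apply: addr_ge0; rewrite mulr_ge0 ?sqr_ge0// ltW// divr_gt0.
(* The crude bound z <= 1 + z^2 avoids square roots. *)
have sq_le (z c : R) : z ^+ 2 <= c -> z <= 1 + c.
  have := sqr_ge0 (z - 1); have := sqr_ge0 z; nra.
have lamB k : (k1 <= k)%N -> l2norm (lambda k - ls) <= 1 + 2 * B.
  move=> kk; apply: sq_le.
  have := EB _ kk; rewrite energyE.
  have := mulr_ge0 (ltW (w0 _ kk)) (g0 _ kk).
  have := mulr_ge0 (ltW al0) (sqr_ge0 (l2norm (y k - xs))); lra.
have yB k : (k1 <= k)%N -> l2norm (y k - xs) <= 1 + 2 * B / (alpha - 1).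
  move=> kk; apply: sq_le; rewrite ler_pdivlMr//.
  have := EB _ kk; rewrite energyE.
  have := mulr_ge0 (ltW (w0 _ kk)) (g0 _ kk).
  have := sqr_ge0 (l2norm (lambda k - ls)); lra.
have [C rC] : exists C, forall k, (k1 < k)%N -> w k * l2norm (r k) <= C.
  have [|||||C WC] := @bounded_of_increments _ _ (fun j => r (k1 + j)%N)
    (fun j => lambda (k1 + j)%N - ls) (fun j => w (k1 + j)%N)
    (fun j => W (k1 + j)%N) (1 + 2 * B).
  - by move=> k; rewrite ltW ?w0 ?leq_addr.
  - by move=> k; rewrite W0 ?leq_addr.
  - by move=> k; rewrite addnS wW ?leq_addr.
  - move=> k; rewrite /= opprB addrA subrK addnS; apply: lambda_increment algo _ _ => //.
    by rewrite (leq_trans _ (leq_addr _ _))// ltnW.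
  - by move=> k; rewrite lamB ?leq_addr.
  (* The lemma weights the residual at [k.+1] by [W k], which dominates [w k.+1]; hence the strict
     inequality [k1 < k]. *)
  exists C; case=> // k kk; apply: le_trans (WC (k - k1)%N).
  by rewrite addnS subnKC// ler_wpM2r ?l2norm_ge0 ?wW.
(* For k >= 2 theta one has k + 1 - theta >= k / 2, so w_k >= k^2 beta_k / (2 (alpha - 1)). *)
have rate k u K : (k1 < k)%N -> 2 * theta <= k%:R -> w k * u <= K -> 0 <= u ->
    u <= 2 * (alpha - 1) * K * `|(k%:R ^+ 2 * beta k)^-1|.
  move=> kk ktheta uK u0; have p0 := kb0 _ (ltnW kk).
  have k0 : 0 < k%:R :> R by rewrite ltr0n (leq_trans _ kk).
  have q0 : 0 < k%:R ^+ 2 * beta k by rewrite expr2 -mulrA mulr_gt0.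
  rewrite ger0_norm ?invr_ge0 ?(ltW q0)// ler_pdivlMr//.
  apply: le_trans (ler_wpM2l _ uK); last by rewrite mulr_ge0 ?ltW.
  have -> : 2 * (alpha - 1) * (w k * u)
      = 2 * u * (k%:R * beta k) * (k%:R + 1 - theta).
    by rewrite /w /s /extrapolation; field; rewrite gt_eqF.
  have : 0 <= u * (k%:R * beta k) by rewrite mulr_ge0 ?(ltW p0).
  have : 0 <= 2 * (k%:R + 1 - theta) - k%:R by lra.
  move=> /mulr_ge0 h /h {}h; lra.
have rB k : (k1 < k)%N -> 2 * theta <= k%:R ->
    l2norm (r k) <= 2 * (alpha - 1) * C * `|(k%:R ^+ 2 * beta k)^-1|.
  by move=> kk kt; apply: rate; rewrite ?rC ?l2norm_ge0.
split.
- exists (Num.max (1 + 2 * B / (alpha - 1) + l2norm xs)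
                  (1 + 2 * B + l2norm ls)) => k kk; rewrite !le_max.
  split; apply/orP; [left|right].
    by rewrite -[y k](subrK xs) (le_trans (l2normD _ _))// lerD2r yB.
  by rewrite -[lambda k](subrK ls) (le_trans (l2normD _ _))// lerD2r lamB.
(* The maximum with 1 provides the positive constant that the big-O characterization asks for. *)
- apply/eqO_exP; exists (Num.max 1 (2 * (alpha - 1) * C)).
    by rewrite lt_max ltr01.
  near=> k; rewrite ger0_norm ?l2norm_ge0//.
  apply: le_trans (rB k _ _) _; last by rewrite ler_wpM2r// le_max lexx orbT.
    by near: k; exact: nbhs_infty_gt.
  by near: k; exact: nbhs_infty_ger.
- exists (2 * (alpha - 1) * B + l2norm ls * (2 * (alpha - 1) * C)).
  near=> k; have kk : (k1 < k)%N by near: k; exact: nbhs_infty_gt.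
  have kt : 2 * theta <= k%:R by near: k; exact: nbhs_infty_ger.
  have xk : f (x k) \is a fin_num.
    by apply: (iterate_fin_num f_proper kkt algo); rewrite (leq_trans k1_ge2)// ltnW.
  rewrite -(fineK xk) -(fineK (xs_fin_num f_proper kkt)) -EFinB !abse_EFin lee_fin.
  rewrite normr_id.
  (* The objective error is the Lagrangian gap minus the pairing of [ls] with the residual, and both
     have the required rate. *)
  have -> : fine (f (x k)) - fine (f xs) = g k - dot ls (r k).
    by rewrite /g /lagrangian_gap addrK.
  apply: le_trans (ler_normB _ _) _; rewrite mulrDl lerD//.
    have gk := g0 _ (ltnW kk); rewrite (ger0_norm gk).
    exact: rate kk kt (wgB _ (ltnW kk)) gk.
  rewrite -mulrA; apply: le_trans (cauchy_schwarz _ _) _.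
  by rewrite ler_wpM2l ?l2norm_ge0 ?rB.
Unshelve. all: by end_near.
Qed.
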